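(* For every $r=4t$ with $r=40$ or $r\ge68$, there exists a binary linear $[n,n-r,3]_2 4,3$ code with $n=2943\cdot2^{t-10}-1$. Consequently $\ell_2(4t,4)\le 2943\cdot2^{t-10}-1$ for $t=10$ and $t\ge17$, and the covering densities $\mu=2^{-r}\sum_{i=0}^4\binom ni$ of these codes tend to $2943^4/(3\cdot2^{43})\approx2.8428$ as $t\to\infty$.
   Context: An $[n,n-r,d]_2R,\ell$ code is a binary linear code of length $n$, codimension $r$, minimum distance $d$, covering radius $R$ (smallest $R$ such that every vector of $\mathbb{F}_2^r$ is a sum of at most $R$ columns of a parity-check matrix $H$), such that some parity-check matrix $H$ admits an $(R,\ell)$-partition: a partition of its columns into nonempty subsets such that every vector of $\mathbb{F}_2^r$ (including zero) is the sum of at least $\ell$ and at most $R$ columns lying in pairwise distinct subsets. $\ell_2(r,R)$ is the smallest length of a binary linear code of codimension $r$ and covering radius $R$. *)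

(* Defs.v *)
From HB Require Import structures.
From mathcomp Require Import all_boot all_order all_algebra.
Set Implicit Arguments. Unset Strict Implicit. Unset Printing Implicit Defensive.
Import Order.TTheory GRing.Theory Num.Theory.
Local Open Scope ring_scope.

(* A binary linear code of length n and codimension r is given as the kernel
   of a parity-check matrix H : 'M['F_2]_(r, n) of full row rank r. *)

Definition full_rank (r n : nat) (H : 'M['F_2]_(r, n)) : bool := \rank H == r.

Definition codeword (r n : nat) (H : 'M['F_2]_(r, n)) (x : 'rV['F_2]_n) : Prop :=
  H *m x^T = 0.

Definition wt (n : nat) (x : 'rV['F_2]_n) : nat := #|[set j | x 0 j != 0]|.

Definition min_dist (r n : nat) (H : 'M['F_2]_(r, n)) (d : nat) : Prop :=
  (exists x, codeword H x /\ x != 0 /\ wt x = d) /\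
  (forall x, codeword H x -> x != 0 -> (d <= wt x)%N).

Definition covers (r n : nat) (H : 'M['F_2]_(r, n)) (R : nat) : Prop :=
  forall v : 'cV['F_2]_r, exists S : {set 'I_n},
    (#|S| <= R)%N /\ \sum_(j in S) col j H = v.

Definition cov_radius (r n : nat) (H : 'M['F_2]_(r, n)) (R : nat) : Prop :=
  covers H R /\ forall R', covers H R' -> (R <= R')%N.

Definition RL_partition (r n : nat) (H : 'M['F_2]_(r, n)) (R l : nat)
    (P : {set {set 'I_n}}) : Prop :=
  partition P [set: 'I_n] /\
  forall v : 'cV['F_2]_r, exists S : {set 'I_n},
    (l <= #|S| <= R)%N /\
    {in S &, forall i j, i != j -> pblock P i != pblock P j} /\
    \sum_(j in S) col j H = v.

Definition is_code_RL (r n d R l : nat) (H : 'M['F_2]_(r, n)) : Prop :=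
  full_rank H /\ min_dist H d /\ cov_radius H R /\
  exists P, RL_partition H R l P.

Definition has_cov_code (r R n : nat) : Prop :=
  exists H : 'M['F_2]_(r, n), full_rank H /\ cov_radius H R.

Definition is_ell2 (r R l : nat) : Prop :=
  has_cov_code r R l /\ forall m, has_cov_code r R m -> (l <= m)%N.

Definition len9p3 (t : nat) : nat := (2943 * 2 ^ (t - 10) - 1)%N.

Definition density (n r : nat) : rat :=
  ((\sum_(i < 5) 'C(n, i))%N)%:R / (2 ^ r)%N%:R.

(* Main.v *)
Require Import Defs.
From Stdlib Require Classical_Prop.
From HB Require Import structures.
From mathcomp Require Import all_boot all_order all_algebra all_field.
From mathcomp Require Import zify ring lra.
Set Implicit Arguments. Unset Strict Implicit. Unset Printing Implicit Defensive.
Import Order.TTheory GRing.Theory Num.Theory.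

(** The [9, 1] repetition code has covering radius 4 and codimension 8.  Each of
    its nine columns [h_j] is replaced by the eight vectors
    [(h_j; s, j s, j^2 s, j^3 s)], [s] in [F_8] (with [j = infinity] allowed), and
    18 further columns are added.  This gives 90 columns in [F_2^20] that can be
    split into 32 classes such that every vector of [F_2^20] is a sum of 3 or 4
    columns from pairwise distinct classes; this finite fact is checked by
    computation.

    Let [q = 2^(t-5) >= 32] and attach distinct elements [g] of [F_q] to the
    classes.  Replace each of the 90 columns [c] by the [q] vectors
    [(c; s, g s, g^2 s, g^3 s)] and add the [q - 1] nonzero vectors
    [(0; 0, 0, 0, s)].  A vector [(w; x)] is covered as follows: write [w] as a sum
    of 3 or 4 columns from distinct classes.  With 4 columns a Vandermonde system
    yields [x]; with 3 columns it yields the first three coordinates of [x], and the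
    fourth one is corrected by some [(0; 0, 0, 0, s)].  Hence every vector is a sum
    of 3 or 4 of these [91 q - 1] distinct columns.  As
    [91 * 2^(t-5) <= 2943 * 2^(t-10)], arbitrary further columns can be added, and
    the partition into singletons is a (4, 3)-partition. *)

Local Open Scope ring_scope.

(** * Matrices over [F_2] and sums of columns *)

Lemma F2_neq0 (a : 'F_2) : a != 0 -> a = 1.
Proof. by case: a => [[|[|]]] // i _; apply/val_inj. Qed.

Lemma addF2_mx (r n : nat) (A : 'M['F_2]_(r, n)) : A + A = 0.
Proof. by apply/matrixP => i j; rewrite !mxE; case: (A i j) => [[|[|]]] // ?; apply/val_inj. Qed.

Lemma mulmx_trF2 (r n : nat) (H : 'M['F_2]_(r, n)) (x : 'rV['F_2]_n) :
  H *m x^T = \sum_(j in [set j | x 0 j != 0]) col j H.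
Proof.
apply/colP => i; rewrite mxE summxE (bigID (fun j => x 0 j != 0)) /=.
rewrite [X in _ + X]big1 ?addr0; last by move=> j /negbNE/eqP; rewrite mxE => ->; rewrite mulr0.
apply: eq_big => [j|j xj]; first by rewrite inE.
by rewrite !mxE (F2_neq0 xj) mulr1.
Qed.

(** Covering the unit vectors already forces the columns to span [F_2^r]. *)
Lemma covers_full_rank (r n R : nat) (H : 'M['F_2]_(r, n)) :
  covers H R -> full_rank H.
Proof.
move=> cov; rewrite /full_rank -mxrank_tr.
suff : row_full H^T by [].
rewrite -sub1mx; apply/row_subP => i.
have [S [_ eS]] := cov (row i 1%:M)^T.
pose x : 'rV['F_2]_n := \row_j (j \in S)%:R.
suff -> : row i 1%:M = x *m H^T by apply: submxMl.
apply: trmx_inj; rewrite trmx_mul trmxK mulmx_trF2 -eS.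
by apply: eq_bigl => j; rewrite !inE mxE; case: (j \in S).
Qed.

(** * A counting bound on the covering radius *)

Lemma bin_leq_expn n k : ('C(n, k) <= n ^ k)%N.
Proof.
apply: leq_trans (_ : n ^_ k <= _)%N.
  by rewrite -bin_ffact leq_pmulr // fact_gt0.
elim: k => [|k IH]; first by rewrite ffactn0.
by rewrite ffactnSr expnSr leq_mul // leq_subr.
Qed.

Lemma card_small_sets n :
  (#|[set S : {set 'I_n} | (#|S| <= 3)%N]| <= n.+1 ^ 3)%N.
Proof.
rewrite -sum1_card.
rewrite (partition_big (fun S : {set 'I_n} => inord #|S| : 'I_4) predT) //=.
apply: (@leq_trans (\sum_(k < 4) 'C(n, k))%N).
  apply: leq_sum => k _; rewrite sum1dep_card.
  have <- : #|[set S : {set 'I_n} | #|S| == k]| = 'C(n, k) by rewrite card_draws card_ord.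
  apply: subset_leq_card; apply/subsetP => S; rewrite !inE => /andP[h /eqP <-].
  by rewrite inordK.
rewrite !big_ord_recl big_ord0 /= addn0 bin0 bin1.
have := bin_leq_expn n 2; have := bin_leq_expn n 3; rewrite /bump /=.
move: 'C(n, _) 'C(n, _) => a b; nia.
Qed.

(** There are at most [1 + n + C(n,2) + C(n,3) <= (n+1)^3] sums of at most three columns, too few
    for [2^r] vectors. *)
Lemma not_covers3 (r n : nat) (H : 'M['F_2]_(r, n)) :
  (n.+1 ^ 3 < 2 ^ r)%N -> ~ covers H 3.
Proof.
move=> hn cov.
suff : (2 ^ r <= n.+1 ^ 3)%N by rewrite leqNgt hn.
apply: leq_trans (card_small_sets n).
have <- : #|[set: 'cV['F_2]_r]| = (2 ^ r)%N by rewrite cardsT card_mx card_Fp ?muln1.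
apply: leq_trans (leq_imset_card (fun S : {set 'I_n} => \sum_(j in S) col j H) _).
apply: subset_leq_card; apply/subsetP => v _.
by have [S [hS eS]] := cov v; apply/imsetP; exists S; rewrite ?inE.
Qed.

(** * From a set of columns to a code with the singleton partition *)

Lemma pblock_singletons (T : finType) (x : T) :
  pblock [set [set y] | y in T] x = [set x].
Proof.
apply: def_pblock; rewrite ?inE //; last by apply/imsetP; exists x.
apply/trivIsetP => A B /imsetP[a _ ->] /imsetP[b _ ->] ab.
by rewrite disjoints1 inE; apply: contra ab => /eqP ->.
Qed.

Lemma partition_singletons (T : finType) :
  partition [set [set y] | y in T] [set: T].
Proof.
apply/and3P; split.
- rewrite eqEsubset subsetT; apply/subsetP => x _; apply/bigcupP.
  by exists [set x]; rewrite ?inE //; apply/imsetP; exists x.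
- apply/trivIsetP => A B /imsetP[a _ ->] /imsetP[b _ ->] ab.
  by rewrite disjoints1 inE; apply: contra ab => /eqP ->.
- by apply/negP => /imsetP[x _ /setP/(_ x)]; rewrite !inE eqxx.
Qed.

(** The elements of [C] become the columns of [H]. Distance 3 comes from distinct nonzero columns
    and the relation among [a], [b], [a + b]; the bound on [n] excludes radius 3. *)
Lemma code_of_columns (r n : nat) (C : {set 'cV['F_2]_r}) (a b : 'cV['F_2]_r) :
  #|C| = n -> 0 \notin C -> (n.+1 ^ 3 < 2 ^ r)%N ->
  a != b -> a \in C -> b \in C -> a + b \in C ->
  (forall v, exists S : {set 'cV['F_2]_r},
     [/\ S \subset C, (3 <= #|S| <= 4)%N & \sum_(c in S) c = v]) ->
  exists H : 'M['F_2]_(r, n), is_code_RL 3 4 3 H.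
Proof.
move=> <- C0 hn ab aC bC abC cov.
pose f (j : 'I_#|C|) : 'cV['F_2]_r := enum_val j.
have fC j : f j \in C by apply: enum_valP.
have f_inj : injective f by apply: enum_val_inj.
pose H : 'M['F_2]_(r, #|C|) := \matrix_(i, j) f j i 0.
have colH j : col j H = f j by apply/colP => i; rewrite !mxE.
have reindexS (S : {set 'cV['F_2]_r}) : S \subset C ->
    #|f @^-1: S| = #|S| /\ \sum_(j in f @^-1: S) col j H = \sum_(c in S) c.
  move=> SC.
  have imf : f @: (f @^-1: S) = S.
    apply/setP => c; apply/imsetP/idP => [[j]|cS]; first by rewrite inE => ? ->.
    have cC := subsetP SC c cS.
    by exists (enum_rank_in cC c); rewrite ?inE /f enum_rankK_in.
  split; first by rewrite -[in RHS]imf card_imset.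
  by rewrite -[in RHS]imf big_imset /=; [apply: eq_bigr|move=> ? ? _ _; apply: f_inj].
have cov34 v : exists S : {set 'I_#|C|}, (3 <= #|S| <= 4)%N /\ \sum_(j in S) col j H = v.
  have [S [SC cS <-]] := cov v; have [c1 c2] := reindexS S SC.
  by exists (f @^-1: S); rewrite c1.
have cov4 : covers H 4 by move=> v; have [S [/andP[_ ?] ?]] := cov34 v; exists S.
exists H; split; first exact: covers_full_rank cov4.
split; last split.
- split.
    (* If [a + b] were [a] or [b], the other one would be zero. *)
    have abn : a + b \notin [set a; b].
      rewrite !inE; apply/norP; split.
        by rewrite -subr_eq0 addrC addKr; apply: contraNneq C0 => <-.
      by rewrite -subr_eq0 addrK; apply: contraNneq C0 => <-.
    pose S := (a + b) |: [set a; b].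
    have SC : S \subset C by rewrite !subUset !sub1set abC aC bC.
    have [cS sS] := reindexS S SC.
    have {}cS : #|f @^-1: S| = 3 by rewrite cS cardsU1 abn cards2 ab.
    pose x : 'rV['F_2]_#|C| := \row_j (j \in f @^-1: S)%:R.
    have supp : [set j | x 0 j != 0] = f @^-1: S.
      by apply/setP => j; rewrite inE mxE; case: (j \in _); rewrite ?oner_eq0 ?eqxx.
    exists x; split; last split.
    + rewrite /codeword mulmx_trF2 supp sS big_setU1 //= big_setU1 /= ?inE //.
      by rewrite big_set1 addF2_mx.
    + apply: contraTneq isT => x0; move: cS; rewrite -supp x0.
      by rewrite (_ : [set j | _] = set0) ?cards0 //; apply/setP => j; rewrite !inE mxE eqxx.
    + by rewrite /wt supp.
  move=> x xH x0; rewrite leqNgt; apply/negP; rewrite /wt => hw.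
  move: xH; rewrite /codeword mulmx_trF2; set S := [set j | _] in hw *.
  have : S != set0.
    apply: contraNneq x0 => S0; apply/eqP/rowP => j; rewrite mxE.
    by have /setP/(_ j) := S0; rewrite !inE => /negbFE/eqP.
  (* Weight 1 would give a zero column, weight 2 two equal columns. *)
  rewrite -card_gt0; case eS : #|S| hw => [|[|[|]]] // _ _.
    move/eqP/cards1P: eS => [j ->]; rewrite big_set1 colH => fj0.
    by move: C0; rewrite -fj0 fC.
  move/eqP/cards2P: eS => [j [k [jk ->]]].
  rewrite big_setU1 ?inE //= big_set1 !colH => /eqP; rewrite addr_eq0 => /eqP e.
  case/eqP: jk; apply: f_inj; rewrite e.
  by apply/eqP; rewrite -subr_eq0 -opprD addF2_mx oppr0.
- split=> // R' covR'; case: leqP => // hR; suff : False by []; apply: (not_covers3 (H := H) hn).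
  by move=> v; have [S [hS eS]] := covR' v; exists S; split=> //; apply: leq_trans hS hR.
- exists [set [set y] | y in 'I_#|C|]; split; first exact: partition_singletons.
  move=> v; have [S [hS eS]] := cov34 v; exists S; split=> //; split=> // i j _ _ ij.
  by rewrite !pblock_singletons; apply: contra ij => /eqP/set1_inj ->.
Qed.

(** * Coordinates of a binary field and Vandermonde systems *)

Import VectorInternalTheory.

Lemma v2rD (K : fieldType) (V : vectType K) : {morph @v2r K V : x y / x + y}.
Proof. exact: linearD. Qed.

Lemma binary_field_coords (m : nat) : (0 < m)%N ->
  exists (F : finFieldType) (psi : F -> 'rV['F_2]_m),
    #|F| = (2 ^ m)%N /\ {morph psi : x y / x + y} /\ bijective psi.
Proof.
move=> m0; have [F F2 cF] := pPrimePowerField (isT : prime 2) m0.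
pose V : vectType 'F_2 := pPrimeCharType F2.
have dV : dim V = m.
  by rewrite -dimvf pprimeChar_dimf cF pfactorK.
exists F; rewrite cF.
(* Replacing [m] by [dim V] makes the codomain of [v2r] match the goal. *)
case: m / dV {cF m0}.
exists (fun x : F => v2r (x : V)); split=> //; split.
  by move=> x y; apply: (v2rD (V := V)).
by exists (fun u => r2v u : V) => x; [apply: v2rK|apply: r2vK].
Qed.

Lemma coordinates (m r : nat) : (0 < m)%N -> (20 + 4 * m = r)%N ->
  exists (F : finFieldType) (phi : 'rV['F_2]_20 -> 'rV[F]_4 -> 'cV['F_2]_r),
    [/\ #|F| = (2 ^ m)%N,
        forall u v x y, phi (u + v) (x + y) = phi u x + phi v y,
        forall u v x y, phi u x = phi v y -> u = v /\ x = y &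
        forall c, exists u x, phi u x = c].
Proof.
move=> m0 <-; have [F [psi [cF [psiD [psi' psiK psi'K]]]]] := binary_field_coords m0.
pose phi (u : 'rV['F_2]_20) (x : 'rV[F]_4) : 'cV['F_2]_(20 + 4 * m) :=
  (row_mx u (mxvec (\matrix_(i, j) psi (x 0 i) 0 j)))^T.
exists F, phi; split=> // [u v x y|u v x y|c].
- rewrite /phi -raddfD add_row_mx -raddfD; congr (row_mx _ (mxvec _))^T.
  by apply/matrixP => i j; rewrite !mxE psiD mxE.
- move/trmx_inj/eq_row_mx => [-> /(can_inj mxvecK) exy]; split=> //.
  apply/rowP => i; apply: (can_inj psiK); apply/rowP => j.
  by have /matrixP/(_ i j) := exy; rewrite !mxE.
- exists (lsubmx c^T), (\row_i psi' (row i (vec_mx (rsubmx c^T)))).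
  rewrite /phi -[RHS]trmxK -[in RHS](hsubmxK c^T); congr (row_mx _ _)^T.
  rewrite -[RHS]vec_mxK; congr mxvec; apply/matrixP => i j.
  by rewrite mxE mxE psi'K mxE.
Qed.

(** Distinct nodes make the determinant, a product of differences, nonzero. With [x] indexed by
    [nat], one target serves both [k = 3] and [k = 4]. *)
Lemma vandermonde_solve (F : fieldType) (k : nat) (g : 'I_k -> F) (x : nat -> F) :
  injective g -> exists s : 'I_k -> F,
    forall j, (j < k)%N -> \sum_i s i * g i ^+ j = x j.
Proof.
move=> g_inj.
pose V := Vandermonde k (\row_i g i).
have Vu : V \in unitmx.
  rewrite unitmxE det_Vandermonde unitfE.
  apply/prodf_neq0 => i _; apply/prodf_neq0 => j ij; rewrite !mxE subr_eq0.
  by apply: contraTneq ij => /g_inj ->; rewrite ltnn.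
pose c := invmx V *m (\col_j x j).
exists (fun i => c i 0) => j jk.
have /colP/(_ (Ordinal jk)) : V *m c = \col_j x j by rewrite mulKVmx.
rewrite !mxE /= => <-; apply: eq_bigr => i _.
by rewrite !mxE mulrC.
Qed.

(** * Tries for sets of bit vectors, and layers of sums *)

Fixpoint xorv (h v : seq bool) : seq bool :=
  match h, v with
  | x :: h', y :: v' => (x (+) y) :: xorv h' v'
  | _, _ => v
  end.

Lemma size_xorv h v : size (xorv h v) = size v.
Proof. by elim: h v => [|x h IH] [|y v] //=; rewrite IH. Qed.

Lemma xorvK h : involutive (xorv h).
Proof. by elim: h => [|x h IH] [|y v] //=; rewrite IH addKb. Qed.

(** A decision tree on successive bits, left for [false] and right for [true]. Collapsing full
    subtrees to [TFull] turns fullness into a test of the root. *)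
Inductive trie := TEmpty | TFull | TNode of trie & trie.

(** When the vector ends early, a node accepts if either side does; this symmetric rule lets
    [tmem_translate] hold for all lengths. *)
Fixpoint tmem (t : trie) (v : seq bool) : bool :=
  match t, v with
  | TEmpty, _ => false
  | TFull, _ => true
  | TNode a b, [::] => tmem a [::] || tmem b [::]
  | TNode a b, x :: v' => if x then tmem b v' else tmem a v'
  end.

Definition tnode (a b : trie) : trie :=
  match a, b with
  | TEmpty, TEmpty => TEmpty
  | TFull, TFull => TFull
  | _, _ => TNode a b
  end.

Fixpoint tunion (s t : trie) : trie :=
  match s, t with
  | TEmpty, _ => t
  | TFull, _ => TFull
  | _, TEmpty => s
  | _, TFull => TFull
  | TNode a b, TNode c d => tnode (tunion a c) (tunion b d)
  end.

Fixpoint ttranslate (h : seq bool) (t : trie) : trie :=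
  match h, t with
  | x :: h', TNode a b =>
      if x then TNode (ttranslate h' b) (ttranslate h' a)
      else TNode (ttranslate h' a) (ttranslate h' b)
  | _, _ => t
  end.

Fixpoint tzero (n : nat) : trie :=
  if n is n'.+1 then TNode (tzero n') TEmpty else TFull.

Lemma tmem_node a b v : tmem (tnode a b) v = tmem (TNode a b) v.
Proof. by case: a b v => [||? ?] [||? ?] [|[] ?]. Qed.

Lemma tmem_union s t v : tmem (tunion s t) v -> tmem s v || tmem t v.
Proof.
elim: s t v => [||a IHa b IHb] [||c d] v //=; rewrite ?orbT ?orbF //.
rewrite tmem_node; case: v => [|[] v] /=; [|exact: IHb|exact: IHa].
by case/orP => [/IHa|/IHb] /orP[] ->; rewrite ?orbT.
Qed.

Lemma tmem_translate h t v : tmem (ttranslate h t) v = tmem t (xorv h v).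
Proof.
elim: h t v => [|x h IH] [||a b] [|y v] //=.
  by case: x; rewrite /= !IH; case: (h) => [|? ?] //=; rewrite orbC.
by case: x; case: y; rewrite /= IH.
Qed.

Lemma tmem_zero n v : size v = n -> tmem (tzero n) v -> v = nseq n false.
Proof. by elim: n v => [|n IH] [|[] v] //= [/IH sv] /sv ->. Qed.

Definition shift_layer (cl : seq (seq bool)) (t : trie) : trie :=
  foldr (fun h acc => tunion (ttranslate h t) acc) TEmpty cl.

(** Both operands of each union are built from the old list, so a sum receives at most one vector of
    [cl]. *)
Definition add_class (cl : seq (seq bool)) (st : seq trie) : seq trie :=
  head TEmpty st ::
    [seq tunion ab.2 (shift_layer cl ab.1) | ab <- zip st (behead st)].

(* Entry [k] collects the sums of [k] vectors taken from [k] distinct classes. *)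
Definition layers (n K : nat) (cls : seq (seq (seq bool))) : seq trie :=
  foldr add_class (tzero n :: nseq K TEmpty) cls.

Lemma size_layers n K cls : size (layers n K cls) = K.+1.
Proof.
elim: cls => [|cl cls IH] /=; first by rewrite size_nseq.
by rewrite size_map size_zip size_behead IH /= minnC (minn_idPl (leqnSn K)).
Qed.

Lemma tmem_shift_layer cl t v :
  tmem (shift_layer cl t) v -> exists2 h, h \in cl & tmem t (xorv h v).
Proof.
elim: cl => //= h cl IH /tmem_union/orP[|/IH[h' h'cl h'v]].
  by rewrite tmem_translate => hv; exists h; rewrite ?mem_head.
by exists h'; rewrite // inE h'cl orbT.
Qed.

Definition sumv (n : nat) (p : seq (nat * seq bool)) : seq bool :=
  foldr (fun c acc => xorv c.2 acc) (nseq n false) p.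

Definition class_choice (cls : seq (seq (seq bool))) (p : seq (nat * seq bool)) :=
  uniq (unzip1 p) &&
  all (fun c => (c.1 < size cls)%N && (c.2 \in nth [::] cls c.1)) p.

Lemma class_choice_shift cl cls p :
  class_choice cls p -> class_choice (cl :: cls) [seq (c.1.+1, c.2) | c <- p].
Proof.
move=> /andP[up ap]; rewrite /class_choice all_map /= ap andbT.
rewrite /unzip1 -map_comp (map_comp S fst) map_inj_uniq //; exact: succn_inj.
Qed.

(** A member of layer [k] either avoids the newest class or is some [h] of it plus a member of layer
    [k - 1]. The newest class has index 0, so older indices move up by one. *)
Lemma layersP n K cls k v : size v = n -> tmem (nth TEmpty (layers n K cls) k) v ->
  exists p, [/\ size p = k, class_choice cls p & sumv n p = v].
Proof.
elim: cls k v => [|cl cls IH] k v sv /=.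
  case: k => [/(tmem_zero sv)->|k] /=; first by exists [::].
  by rewrite nth_nseq if_same.
have shift q w : sumv n q = w -> sumv n [seq (c.1.+1, c.2) | c <- q] = w.
  by move=> <-; rewrite /sumv foldr_map.
case: k => [|k] /=.
  rewrite -nth0 => /(IH 0 _ sv)[p [sp cp ep]]; exists [seq (c.1.+1, c.2) | c <- p].
  by rewrite size_map sp class_choice_shift // (shift _ _ ep).
(* Past the last layer [nth] returns [TEmpty], which has no member. *)
case: (ltnP k K) => kK; last first.
  rewrite nth_default // size_map size_zip size_behead size_layers /=.
  by rewrite minnC (minn_idPl (leqnSn K)).
rewrite (nth_map (TEmpty, TEmpty)); last first.
  by rewrite size_zip size_behead size_layers /= minnC (minn_idPl (leqnSn K)).
rewrite nth_zip_cond size_zip size_behead size_layers /= minnC (minn_idPl (leqnSn K)) kK /=.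
rewrite nth_behead => /tmem_union/orP[/(IH _ _ sv)[p [sp cp ep]]|].
  exists [seq (c.1.+1, c.2) | c <- p].
  by rewrite size_map sp class_choice_shift // (shift _ _ ep).
move=> /tmem_shift_layer[h hcl]; move/(IH k); rewrite size_xorv => /(_ sv)[p [sp cp ep]].
exists ((0, h) :: [seq (c.1.+1, c.2) | c <- p]); split.
- by rewrite /= size_map sp.
- have /andP[u a] := class_choice_shift cl cp.
  rewrite /class_choice /= u a hcl !andbT /=; apply/mapP => -[c].
  by case/mapP => c' _ ->.
- by rewrite /= (shift _ _ ep) xorvK.
Qed.

(** * The base code of 90 columns in [F_2^20] *)

Definition bits3 (k : nat) : seq bool := [:: odd k; odd k./2; odd k./2./2].

(* Multiplication of [F_8 = F_2[x] / (x^3 + x + 1)] in the basis [1, x, x^2]. *)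
Definition mul8 (a b : seq bool) : seq bool :=
  match a, b with
  | [:: a0; a1; a2], [:: b0; b1; b2] =>
      let c3 := (a1 && b2) (+) (a2 && b1) in
      let c4 := a2 && b2 in
      [:: (a0 && b0) (+) c3;
          (a0 && b1) (+) (a1 && b0) (+) c3 (+) c4;
          (a0 && b2) (+) (a1 && b1) (+) (a2 && b0) (+) c4]
  | _, _ => [::]
  end.

(* Columns of a parity-check matrix of the [9, 1] repetition code. *)
Definition rep_column (j : nat) : seq bool :=
  if j == 8 then nseq 8 true else [seq i == j | i <- iota 0 8].

(* The point of the line over [F_8] spanned by [(1, j, j^2, j^3)], or by
   [(0, 0, 0, 1)] when [j = 8]. *)
Definition cubic_point (j s : nat) : seq bool :=
  let b := bits3 j in let c := bits3 s in
  if j == 8 then nseq 9 false ++ c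
  else c ++ mul8 b c ++ mul8 b (mul8 b c) ++ mul8 b (mul8 b (mul8 b c)).

Definition lifted_class (j : nat) (ss : seq nat) : seq (seq bool) :=
  [seq rep_column j ++ cubic_point j s | s <- ss].

(** The eleven zeros fill the eight repetition-code coordinates and the first [F_8] coordinate. *)
Definition extra_class (xs : seq (nat * nat * nat)) : seq (seq bool) :=
  [seq nseq 11 false ++ bits3 x.1.1 ++ bits3 x.1.2 ++ bits3 x.2 | x <- xs].

(* The extra columns [(0; 0, 1, 0, s)], [(0; 0, 7, s, 0)], [(0; 0, 4, 0, 0)] and
   [(0; 0, 3, 0, 0)] and the distribution over 32 classes were found by computer
   search. *)
Definition base_classes : seq (seq (seq bool)) :=
  [:: extra_class [:: (7, 3, 0)];
      extra_class [:: (1, 0, 1); (1, 0, 4); (1, 0, 6); (3, 0, 0)];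
      extra_class [:: (7, 4, 0); (7, 5, 0); (7, 7, 0)];
      extra_class [:: (7, 0, 0); (7, 1, 0); (7, 2, 0); (7, 6, 0)];
      extra_class [:: (1, 0, 0); (1, 0, 2); (1, 0, 3); (1, 0, 5); (1, 0, 7); (4, 0, 0)]]
  ++ [seq lifted_class j ss |
       j <- iota 0 9, ss <- [:: [:: 0; 1; 3]; [:: 4; 5; 6]; [:: 2; 7]]].

Definition is_full (t : trie) : bool := if t is TFull then true else false.

Definition full_layers34 (st : seq trie) : bool :=
  is_full (tunion (nth TEmpty st 3) (nth TEmpty st 4)).

Lemma layers_full n cls v : full_layers34 (layers n 4 cls) -> size v = n ->
  exists p, [/\ (3 <= size p <= 4)%N, class_choice cls p & sumv n p = v].
Proof.
rewrite /full_layers34 => full sv.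
have : tmem (tunion (nth TEmpty (layers n 4 cls) 3) (nth TEmpty (layers n 4 cls) 4)) v.
  by move: full; case: (tunion _ _).
by case/tmem_union/orP => /(layersP sv)[p [sp cp ep]]; exists p; rewrite sp.
Qed.

(** The finite check: layers 3 and 4 together evaluate to [TFull]. The cast leaves the evaluation to
    [Qed]. *)
Lemma base_fullT : full_layers34 (layers 20 4 base_classes).
Proof. by vm_cast_no_check (erefl true). Qed.

Definition base_columns : seq (nat * seq bool) :=
  flatten [seq [seq (k, h) | h <- nth [::] base_classes k] | k <- iota 0 32].

Definition bitrow (n : nat) (v : seq bool) : 'rV['F_2]_n :=
  \row_i (nth false v i)%:R.

(** The bound on sizes matters because [xorv] truncates to the length of [v]. *)
Lemma bitrow_xor n h v : (size h <= size v)%N ->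
  bitrow n (xorv h v) = bitrow n h + bitrow n v.
Proof.
move=> hv; apply/rowP => i; rewrite !mxE.
have -> : nth false (xorv h v) i = nth false h i (+) nth false v i.
  elim: h v (nat_of_ord i) hv => [|x h IH] [|y v] [|k] //= hv; exact: IH.
by case: (nth false h i); case: (nth false v i); apply/val_inj.
Qed.

Lemma bitrow_zero n : bitrow n (nseq n false) = 0.
Proof. by apply/rowP => i; rewrite !mxE nth_nseq if_same. Qed.

Lemma bitrow_inj n u v : size u = n -> size v = n -> bitrow n u = bitrow n v -> u = v.
Proof.
move=> su sv /rowP uv; apply: (@eq_from_nth _ false) => [|i iu]; first by rewrite sv.
rewrite su in iu; have := uv (Ordinal iu); rewrite !mxE /=.
by case: (nth false u i); case: (nth false v i).
Qed.

Lemma bitrow_surj n (w : 'rV['F_2]_n) : exists2 v, size v = n & bitrow n v = w.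
Proof.
exists [seq w 0 i != 0 | i <- enum 'I_n]; first by rewrite size_map size_enum_ord.
apply/rowP => i; rewrite mxE (nth_map i) ?size_enum_ord // nth_ord_enum.
by case: (w 0 i) => [[|[|]]] // j; apply/val_inj.
Qed.

Definition base_code : seq (nat * 'rV['F_2]_20) :=
  [seq (c.1, bitrow 20 c.2) | c <- base_columns].

Lemma size_base_code : size base_code = 90%N.
Proof. by rewrite size_map; vm_compute. Qed.

Lemma base_columns_size : all (fun c => size c.2 == 20) base_columns.
Proof. by vm_compute. Qed.

(** [bitrow] is injective on lists of length 20, which reduces the claim to a computation on bit
    lists. *)
Lemma uniq_base_code : uniq (unzip2 base_code).
Proof.
rewrite /unzip2 -map_comp (map_comp (bitrow 20) snd) map_inj_in_uniq.
  by vm_compute.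
move=> u v /mapP[c cB ->] /mapP[d dB ->]; apply: bitrow_inj; apply/eqP.
  exact: (allP base_columns_size).
exact: (allP base_columns_size).
Qed.

Lemma base_code_neq0 : 0 \notin unzip2 base_code.
Proof.
rewrite /unzip2 -map_comp (map_comp (bitrow 20) snd); apply/mapP => -[u uB].
rewrite -(bitrow_zero 20) => /esym/bitrow_inj u0.
have su : size u = 20 by case/mapP: uB => c cB ->; apply/eqP/(allP base_columns_size).
by move: uB; rewrite u0 ?size_nseq //; apply/negP; vm_compute.
Qed.

Lemma base_code_colour c : c \in base_code -> (c.1 < 32)%N.
Proof.
case/mapP => d dB ->; move: dB => /flattenP[l] /mapP[k]; rewrite mem_iota => /andP[_ k32].
by move=> -> /mapP[h _ ->].
Qed.

Lemma base_code_cover (w : 'rV['F_2]_20) :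
  exists p, [/\ (3 <= size p <= 4)%N, uniq (unzip1 p), {subset p <= base_code} &
                \sum_(c <- p) c.2 = w].
Proof.
have [v sv <-] := bitrow_surj w.
suff [p [sp cp <-]] : exists p, [/\ (3 <= size p <= 4)%N, class_choice base_classes p &
    sumv 20 p = v].
  have /andP[up ap] := cp.
  have pB : {subset p <= base_columns}.
    move=> c /(allP ap)/andP[ck cin]; apply/flattenP.
    exists [seq (c.1, h) | h <- nth [::] base_classes c.1].
      by apply/mapP; exists c.1; rewrite // mem_iota.
    by apply/mapP; exists c.2; rewrite // -surjective_pairing.
  exists [seq (c.1, bitrow 20 c.2) | c <- p]; split.
  - by rewrite size_map.
  - by rewrite /unzip1 -map_comp.
  - by move=> _ /mapP[c cp' ->]; apply/map_f/pB.
  rewrite big_map /=; elim: p pB {sp cp up ap} => [|c p IH] pB.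
    by rewrite big_nil /= bitrow_zero.
  have sB d : d \in c :: p -> size d.2 = 20.
    by move=> /pB dB; apply/eqP/(allP base_columns_size).
  rewrite big_cons /= bitrow_xor; last first.
    rewrite sB ?mem_head //.
    have -> : size (foldr (fun c acc => xorv c.2 acc) (nseq 20 false) p) = 20.
      by elim: (p) => [|d q] //=; rewrite size_xorv.
    by [].
  by rewrite IH // => d dp; apply: pB; rewrite inE dp orbT.
exact: layers_full base_fullT sv.
Qed.

(** * Extension of column sets and the lift of the base code *)

Lemma superset_of_card (T : finType) (A B : {set T}) n :
  A \subset B -> (#|A| <= n <= #|B|)%N ->
  exists C : {set T}, [/\ A \subset C, C \subset B & #|C| = n].
Proof.
move=> AB /andP[An nB].
have D_uniq : uniq (take (n - #|A|) (enum (B :\: A))) by rewrite take_uniq ?enum_uniq.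
set D := take _ _ in D_uniq.
have DBA x : x \in D -> x \in B :\: A by move=> /mem_take; rewrite mem_enum.
exists (A :|: [set x in D]); split; first exact: subsetUl.
  rewrite subUset AB; apply/subsetP => x; rewrite inE => /DBA.
  by rewrite inE => /andP[].
rewrite cardsU (_ : A :&: _ = set0) ?cards0 ?subn0; last first.
  apply/setP => x; rewrite !inE; apply/negP => /andP[xA /DBA].
  by rewrite inE xA.
rewrite cardsE (card_uniqP D_uniq) size_takel ?subnKC //.
by rewrite -cardE cardsD (setIidPr AB) leq_sub2r.
Qed.

Lemma uniq_map_inj (T1 T2 : eqType) (f : T1 -> T2) (s : seq T1) :
  uniq (map f s) -> {in s &, injective f}.
Proof.
move=> uf x y xs ys fxy.
have xi : (index x s < size s)%N by rewrite index_mem.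
have yi : (index y s < size s)%N by rewrite index_mem.
have /eqP : index x s == index y s.
  rewrite -(nth_uniq (f x) _ _ uf) ?size_map // !(nth_map x) //.
  by rewrite !nth_index // fxy.
by move/(congr1 (nth x s)); rewrite !nth_index.
Qed.

(** The point [(1, g, g^2, g^3)] of the twisted cubic. *)
Definition twisted_row (F : fieldType) (g : F) : 'rV[F]_4 := \row_j g ^+ j.

Section Lift.

Variables (F : finFieldType) (r : nat).
Variable phi : 'rV['F_2]_20 -> 'rV[F]_4 -> 'cV['F_2]_r.
Hypothesis phiD : forall u v x y, phi (u + v) (x + y) = phi u x + phi v y.
Hypothesis phi_inj : forall u v x y, phi u x = phi v y -> u = v /\ x = y.
Hypothesis phi_surj : forall c, exists u x, phi u x = c.

Variable gamma : nat -> F.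
Hypothesis gamma_inj : {in gtn 32 &, injective gamma}.

(** For nonzero [s], the columns of a Hamming code placed in the last coordinate. *)
Definition hamming_column (s : F) : 'cV['F_2]_r := phi 0 (s *: delta_mx 0 ord_max).

Definition lift_column (c : nat * 'rV['F_2]_20) (s : F) : 'cV['F_2]_r :=
  phi c.2 (s *: twisted_row (gamma c.1)).

Definition lift_columns : {set 'cV['F_2]_r} :=
  [set lift_column (nth (0%N, 0) base_code is'.1) is'.2 |
     is' : 'I_(size base_code) * F] :|:
  [set hamming_column s | s in [set~ 0]].

Lemma phi0 : phi 0 0 = 0.
Proof. by apply: (addrI (phi 0 0)); rewrite addr0 -phiD !addr0. Qed.

(** The count is [90 q + (q - 1)]; an upper bound suffices, since columns are added later to reach
    the exact length. *)
Lemma card_lift_columns : (#|lift_columns| <= 91 * #|F| - 1)%N.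
Proof.
rewrite cardsU; apply: leq_trans (leq_subr _ _) _.
apply: leq_trans (leq_add (leq_imset_card _ _) (leq_imset_card _ _)) _.
rewrite card_prod card_ord size_base_code cardsC1.
have q0 : (0 < #|F|)%N by apply/card_gt0P; exists 0.
by rewrite -subn1 addnBA // leq_sub2r // (mulSnr 90).
Qed.

Lemma mem_lift_column c s : c \in base_code -> lift_column c s \in lift_columns.
Proof.
move=> cB; rewrite inE; apply/orP; left; apply/imsetP.
have ci : (index c base_code < size base_code)%N by rewrite index_mem.
by exists (Ordinal ci, s); rewrite //= nth_index.
Qed.

Lemma mem_hamming_column s : s != 0 -> hamming_column s \in lift_columns.
Proof. by move=> s0; rewrite inE imset_f ?orbT // !inE. Qed.

Lemma hamming_column_inj : injective hamming_column.
Proof.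
move=> s t /phi_inj[_ /rowP/(_ ord_max)].
by rewrite !mxE !eqxx !mulr1.
Qed.

Lemma hamming_columnD s t : hamming_column (s + t) = hamming_column s + hamming_column t.
Proof. by rewrite /hamming_column -phiD addr0 scalerDl. Qed.

Lemma lift_column_neq_hamming c s t : c \in base_code ->
  lift_column c s != hamming_column t.
Proof.
move=> cB; apply: contra_not_neq (negP base_code_neq0) => /phi_inj[c0 _].
by rewrite -c0 map_f.
Qed.

Lemma lift_columns_neq0 : 0 \notin lift_columns.
Proof.
have h0 : hamming_column 0 = 0 by rewrite /hamming_column scale0r phi0.
rewrite inE; apply/norP; split; apply/imsetP.
  move=> [[i s] _ /= e].
  have := lift_column_neq_hamming s 0 (mem_nth (0%N, 0) (ltn_ord i)).
  by rewrite h0 -e eqxx.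
move=> [s]; rewrite !inE => s0 e; move/eqP: s0; apply.
by apply: hamming_column_inj; rewrite h0 -e.
Qed.

Lemma phi_sum (I : finType) (u : I -> 'rV['F_2]_20) (x : I -> 'rV[F]_4) :
  phi (\sum_i u i) (\sum_i x i) = \sum_i phi (u i) (x i).
Proof.
apply: (big_ind3 (fun u x v => phi u x = v)) => // [|u1 u2 v1 x1 x2 v2 <- <-].
  exact: phi0.
exact: phiD.
Qed.

(** The coefficients [s] settle as many coordinates of [x] as there are base columns, and [rest] is
    the defect in the fourth. A nonzero [rest] costs one Hamming column and occurs only with three
    base columns. *)
Lemma lift_cover v : exists S : {set 'cV['F_2]_r},
  [/\ S \subset lift_columns, (3 <= #|S| <= 4)%N & \sum_(c in S) c = v].
Proof.
have [w [x <-]] := phi_surj v.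
have [p [sp up pB sum_p]] := base_code_cover w.
pose d := (0%N, 0) : nat * 'rV['F_2]_20.
pose c (i : 'I_(size p)) := nth d p i.
have cp i : c i \in p by apply: mem_nth.
have cB i : c i \in base_code by apply: pB.
have g_inj : injective (fun i => gamma (c i).1).
  move=> i j gij; apply/ord_inj/eqP.
  rewrite -(nth_uniq 0%N _ _ up) ?size_map // /unzip1 !(nth_map d) //; apply/eqP.
  by apply: gamma_inj gij; rewrite inE base_code_colour.
have [s sE] := vandermonde_solve (fun j => x 0 (inord j)) g_inj.
pose rest := x 0 ord_max - \sum_i s i * gamma (c i).1 ^+ 3.
pose f i := lift_column (c i) (s i).
(* The [F_2^20] parts alone separate the columns, since base vectors do not repeat. *)
have f_inj : injective f.
  move=> i j /phi_inj[e _]; apply/ord_inj/eqP.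
  rewrite -(nth_uniq d _ _ (map_uniq up)) //; apply/eqP.
  exact: (uniq_map_inj (f := snd) uniq_base_code (cB i) (cB j) e).
have sum_f : \sum_i f i + hamming_column rest = phi w x.
  rewrite -phi_sum -phiD addr0; congr phi.
    by rewrite -sum_p (big_nth d) big_mkord.
  apply/rowP => j; rewrite !mxE summxE eqxx /=.
  under eq_bigr => i _ do rewrite !mxE.
  have [jp|pj] := ltnP j (size p).
    rewrite sE // inord_val; case: eqP => [ej|_]; last by rewrite mulr0 addr0.
    rewrite /rest; have sp4 : (3 < size p)%N by rewrite ej in jp.
    by rewrite (sE 3) // ej (_ : inord 3 = ord_max) ?subrr ?mul0r ?addr0 //;
      apply/val_inj; rewrite /= inordK.
  (* Only the fourth coordinate can lie beyond [size p], and [rest] repairs it. *)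
  have -> : j = ord_max by apply/val_inj/eqP; move: (ltn_ord j) pj sp => /=; lia.
  by rewrite eqxx mulr1 addrC subrK.
have cardf : #|f @: setT| = size p by rewrite card_imset // cardsT card_ord.
have fC : f @: setT \subset lift_columns.
  by apply/subsetP => _ /imsetP[i _ ->]; apply: mem_lift_column.
have sumf : \sum_(a in f @: setT) a = \sum_i f i.
  rewrite big_imset /=; last by move=> i j _ _; apply: f_inj.
  by apply: eq_bigl => i; rewrite inE.
have [rest0|rest0] := eqVneq rest 0.
  exists (f @: setT); split; rewrite ?cardf // sumf -sum_f rest0.
  by rewrite /hamming_column scale0r phi0 addr0.
have notin : hamming_column rest \notin f @: setT.
  by apply/imsetP => -[i _ /esym/eqP]; apply/negP/lift_column_neq_hamming.
exists (hamming_column rest |: f @: setT); split.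
- by rewrite subUset fC sub1set mem_hamming_column.
- rewrite cardsU1 notin cardf.
  (* With four base columns the system includes the fourth coordinate, so [rest] would be 0. *)
  have [sp3|sp4] := ltnP (size p) 4; first by move: sp; lia.
  case/eqP: rest0; rewrite /rest (sE 3) // (_ : inord 3 = ord_max) ?subrr //.
  by apply/val_inj; rewrite /= inordK.
- by rewrite big_setU1 //= sumf addrC sum_f.
Qed.

End Lift.

(** [5 <= m] supplies 32 labels for the classes; the cubic bound excludes radius 3 and also ensures
    that [n] nonzero vectors exist. *)
Lemma lift_code (m r n : nat) : (5 <= m)%N -> (20 + 4 * m = r)%N ->
  (91 * 2 ^ m <= n.+1)%N -> (n.+1 ^ 3 < 2 ^ r)%N ->
  exists H : 'M['F_2]_(r, n), is_code_RL 3 4 3 H.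
Proof.
move=> m5 er hn nr; have m0 : (0 < m)%N by apply: leq_trans m5.
have [F [phi [cF phiD phi_inj phi_surj]]] := coordinates m0 er.
have F32 : (32 <= #|F|)%N by rewrite cF (@leq_pexp2l 2 5).
pose gamma k := nth 0 (enum F) k.
have gamma_inj : {in gtn 32 &, injective gamma}.
  move=> i j; rewrite !inE => i32 j32 /eqP.
  by rewrite nth_uniq ?enum_uniq -?cardE ?(leq_trans _ F32) // => /eqP.
pose K := lift_columns phi gamma.
have [C [KC C0 cC]] : exists C : {set 'cV['F_2]_r}, [/\ K \subset C, C \subset [set~ 0] & #|C| = n].
  apply: superset_of_card.
    rewrite subsetC sub1set inE; exact: lift_columns_neq0.
  apply/andP; split.
    apply: leq_trans (card_lift_columns phi gamma) _.
    by rewrite cF leq_subLR add1n.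
  rewrite cardsC1 card_mx card_Fp // muln1 -ltnS prednK ?expn_gt0 //.
  apply: leq_ltn_trans nr; apply: leq_trans (leqnSn n) _.
  exact: (@leq_pexp2l n.+1 1 3).
have ham s : s != 0 -> hamming_column phi s \in C.
  by move=> s0; apply: (subsetP KC); apply: mem_hamming_column.
(* The Hamming columns of [1], [a] and [1 + a] will form the codeword of weight 3. *)
have [a a0 a1] : exists2 a : F, a != 0 & a != 1.
  have : ~~ ([set: F] \subset [set 0; 1]).
    apply: contraL F32 => /subset_leq_card; rewrite cardsT -ltnNge => h.
    by apply: leq_ltn_trans h _; rewrite cards2; case: (_ != _).
  by case/subsetPn => a _; rewrite !inE negb_or => /andP[? ?]; exists a.
have hinj := hamming_column_inj phi_inj.
apply: (@code_of_columns r n C (hamming_column phi 1) (hamming_column phi a)) => //.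
- by apply/negP => /(subsetP C0); rewrite !inE eqxx.
- by rewrite (inj_eq hinj) eq_sym.
- by rewrite ham ?oner_eq0.
- exact: ham.
- rewrite -(hamming_columnD phiD) ham //.
  (* Characteristic two of [F] is read off from the image under [phi], where every vector is its own
     negative. *)
  apply: contra a1; rewrite addr_eq0 => /eqP e1.
  apply/eqP/hinj; have : hamming_column phi 1 + hamming_column phi a = 0.
    by rewrite -(hamming_columnD phiD) e1 addNr /hamming_column scale0r (phi0 phiD).
  by move/eqP; rewrite addr_eq0 => /eqP ->; apply/eqP; rewrite -addr_eq0 addF2_mx.
- move=> v; have [S [SK cS sS]] := lift_cover phiD phi_inj phi_surj gamma_inj v.
  by exists S; split=> //; apply: subset_trans KC.
Qed.

(** * The lengths [2943 * 2^(t-10) - 1] and minimal lengths *)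

Lemma len9p3E t : (len9p3 t).+1 = (2943 * 2 ^ (t - 10))%N.
Proof. by rewrite /len9p3 subn1 prednK // muln_gt0 expn_gt0. Qed.

(** With [m = t - 5], the length condition reduces to [91 * 32 = 2912 <= 2943]. *)
Lemma len9p3_code t : (10 <= t)%N ->
  exists H : 'M['F_2]_(4 * t, len9p3 t), is_code_RL 3 4 3 H.
Proof.
move=> t10; apply: (@lift_code (t - 5)); [lia|lia| |]; rewrite len9p3E.
  have -> : (t - 5 = 5 + (t - 10))%N by lia.
  by rewrite expnD mulnA leq_mul2r orbC.
(* The 36 is [3 * 12], from [2943 < 2^12]. *)
have -> : (4 * t = 36 + (t - 10) * 3 + (4 + (t - 10)))%N by lia.
rewrite expnMn -expnM expnD; apply: leq_trans (leq_pmulr _ _); last by rewrite expn_gt0.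
by rewrite expnD ltn_mul2r expn_gt0 (expnM 2 12 3) ltn_exp2r.
Qed.

(** Descent on the length; excluded middle decides whether a shorter code exists. *)
Lemma min_length_exists (r R n : nat) : has_cov_code r R n ->
  exists l, is_ell2 r R l /\ (l <= n)%N.
Proof.
elim/ltn_ind: n => n IH hn.
have [[k [kn hk]]|min_n] := Classical_Prop.classic (exists k, (k < n)%N /\ has_cov_code r R k).
  by have [l [hl lk]] := IH k kn hk; exists l; split=> //; apply: leq_trans lk (ltnW kn).
exists n; split=> //; split=> // m hm; rewrite leqNgt; apply/negP => mn.
by apply: min_n; exists m.
Qed.

(** * The limit of the covering densities *)

Lemma natr_ffact (R : pzRingType) (n k : nat) :
  (n ^_ k)%:R = \prod_(i < k) (n%:R - i%:R) :> R.
Proof.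
elim: k => [|k IH]; first by rewrite ffactn0 big_ord0.
rewrite ffactnSr natrM IH big_ord_recr /=.
(* For [n < k] both sides vanish, the product through its factor at [i = n]. *)
have [kn|nk] := leqP k n; first by rewrite natrB.
by rewrite -IH ffact_small // !mul0r.
Qed.

(** The ball volume is expanded in [y = n + 1], because [n + 1] is the pure product
    [2943 * 2^(t-10)]. *)
Lemma sum_bin_lt5 (R : numFieldType) (n : nat) (y : R) : n%:R = y - 1 ->
  24 * (\sum_(i < 5) 'C(n, i))%N%:R = y ^+ 4 - 6 * y ^+ 3 + 23 * y ^+ 2 - 18 * y + 24.
Proof.
move=> ny; rewrite natr_sum !big_ord_recr big_ord0 /=.
have ff k : 'C(n, k)%:R * (k`!)%:R = \prod_(i < k) (n%:R - i%:R) :> R.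
  by rewrite -natrM bin_ffact natr_ffact.
have := ff 4; have := ff 3; have := ff 2; have := ff 1%N; have := ff 0%N.
rewrite !big_ord_recr !big_ord0 /= !factS fact0 ny.
move: ('C(n, 0)%:R) ('C(n, 1)%:R) ('C(n, 2)%:R) ('C(n, 3)%:R) ('C(n, 4)%:R).
move=> c0 c1 c2 c3 c4 e0 e1 e2 e3 e4.
have {}e1 : c1 * 1%:R = 1 * (y - 1 - 0) := e1.
have {}e2 : c2 * 2%:R = 1 * (y - 1 - 0) * (y - 1 - 1%:R) := e2.
have {}e3 : c3 * 6%:R = 1 * (y - 1 - 0) * (y - 1 - 1%:R) * (y - 1 - 2%:R) := e3.
have {}e4 : c4 * 24%:R =
  1 * (y - 1 - 0) * (y - 1 - 1%:R) * (y - 1 - 2%:R) * (y - 1 - 3%:R) := e4.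
(* Each coefficient is [24 / k!], which prepares the substitution of [e0] to [e4]. *)
have -> : 24 * (0 + c0 + c1 + c2 + c3 + c4) =
  24 * (c0 * 1) + 24 * (c1 * 1%:R) + 12 * (c2 * 2%:R) + 4 * (c3 * 6%:R) + c4 * 24%:R.
  by ring.
by rewrite e0 e1 e2 e3 e4; ring.
Qed.

Lemma density_error (R : realFieldType) (x c P S : R) :
  1 <= x -> 1 <= c -> 0 < P -> 71 * c ^+ 3 <= 24 * P ->
  24 * S = (c * x) ^+ 4 - 6 * (c * x) ^+ 3 + 23 * (c * x) ^+ 2 - 18 * (c * x) + 24 ->
  `| S / (P * x ^+ 4) - c ^+ 4 / (24 * P) | <= x^-1.
Proof.
move=> x1 c1 P0 cP eS; have x0 : 0 < x by apply: lt_le_trans x1.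
set y := c * x in eS; have y1 : 1 <= y by rewrite /y; nra.
pose D := - 6 * y ^+ 3 + 23 * y ^+ 2 - 18 * y + 24.
have -> : S / (P * x ^+ 4) - c ^+ 4 / (24 * P) = D / (24 * P * x ^+ 4).
  have -> : S = (y ^+ 4 + D) / 24 by rewrite /D; lra.
  by rewrite /y; field; rewrite !gt_eqF.
have y2 : y <= y ^+ 2 by rewrite expr2 ler_peMr //; lra.
have y3 : y ^+ 2 <= y ^+ 3 by rewrite [leRHS]exprSr ler_peMr // sqr_ge0.
have hD : `|D| <= 24 * P * x ^+ 3.
  (* [71 = 6 + 23 + 18 + 24] sums the absolute coefficients of [D]; all powers are at most [y ^+ 3]
     as [1 <= y]. *)
  apply: (@le_trans _ _ (71 * y ^+ 3)); first by rewrite /D ler_norml; apply/andP; split; lra.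
  by rewrite /y exprMn mulrA ler_pM2r // exprn_gt0.
have d0 : 0 < 24 * P * x ^+ 4 by rewrite !mulr_gt0 // exprn_gt0.
rewrite normrM normfV (gtr0_norm d0) ler_pdivrMr //; apply: le_trans hD _.
rewrite (_ : x^-1 * _ = 24 * P * x ^+ 3) //; field.
by rewrite gt_eqF.
Qed.

Lemma mul3_exp43 : (3 * 2 ^ 43 = 24 * 2 ^ 40)%N.
Proof. by rewrite -[43%N]/(3 + 40)%N expnD; move: (2 ^ 40)%N => P; lia. Qed.

Lemma density_error_nat (R : realFieldType) (n x c P : nat) :
  (0 < x)%N -> (0 < c)%N -> (0 < P)%N -> (71 * c ^ 3 <= 24 * P)%N ->
  n.+1 = (c * x)%N ->
  `| (\sum_(i < 5) 'C(n, i))%N%:R / (P * x ^ 4)%N%:R - (c ^ 4)%N%:R / (24 * P)%N%:R |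
    <= x%:R^-1 :> R.
Proof.
move=> x0 c0 P0 cP en; rewrite (natrM _ P) (natrM _ 24) (natrX _ x) (natrX _ c).
apply: density_error.
- by rewrite (ler_nat _ 1).
- by rewrite (ler_nat _ 1).
- by rewrite ltr0n.
- by rewrite -natrX -(natrM _ 71) -(natrM _ 24) ler_nat.
- by apply: sum_bin_lt5; rewrite -natrM -en -natr1 addrK.
Qed.

Lemma density_len9p3 t : (10 <= t)%N ->
  `| density (len9p3 t) (4 * t) - (2943 ^ 4)%N%:R / (3 * 2 ^ 43)%N%:R | <=
    (2 ^ (t - 10))%N%:R^-1.
Proof.
move=> t10; rewrite /density mul3_exp43.
have -> : (4 * t = 40 + (t - 10) * 4)%N by lia.
rewrite (expnD 2 40) (expnM 2 (t - 10) 4).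
apply: (@density_error_nat _ (len9p3 t) (2 ^ (t - 10)) 2943 (2 ^ 40)).
- by rewrite expn_gt0.
- by [].
- by rewrite expn_gt0.
(* Here [2943 <= 2^12] and [71 <= 24 * 2^4]. *)
- apply: (@leq_trans (71 * (2 ^ 12) ^ 3)%N); first by rewrite leq_mul2l leq_exp2r.
  by rewrite -expnM (expnD 2 4 36) mulnA leq_mul2r orbC.
- exact: len9p3E.
Qed.

Lemma density_len9p3_cvg (eps : rat) : 0 < eps ->
  exists N : nat, forall t : nat, (N <= t)%N ->
    `| density (len9p3 t) (4 * t) - (2943 ^ 4)%N%:R / (3 * 2 ^ 43)%N%:R | < eps.
Proof.
move=> eps0; have [k hk] : exists k, eps^-1 < k%:R.
  by exists (Num.bound eps^-1); apply: archi_boundP; rewrite invr_ge0 ltW.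
exists (10 + k)%N => t ht.
(* The error is at most [2^-(t-10)], and [1/eps < k < 2^k <= 2^(t-10)]. *)
have t10 : (10 <= t)%N by apply: leq_trans (leq_addr _ _) ht.
apply: le_lt_trans (density_len9p3 t10) _.
rewrite invf_plt ?posrE ?ltr0n ?expn_gt0 //; apply: lt_trans hk _.
rewrite ltr_nat; apply: leq_trans (ltn_expl k (isT : 1 < 2)%N) _.
by rewrite leq_exp2l // leq_subRL.
Qed.

Local Close Scope ring_scope.

Theorem theorem9p3 :
  (forall t : nat, (t = 10 \/ 17 <= t)%N ->
     exists H : 'M['F_2]_(4 * t, len9p3 t), is_code_RL 3 4 3 H) /\
  (forall t : nat, (t = 10 \/ 17 <= t)%N ->
     exists l, is_ell2 (4 * t) 4 l /\ (l <= len9p3 t)%N) /\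
  (forall eps : rat, (0 < eps)%R -> exists N : nat, forall t : nat, (N <= t)%N ->
     (`| density (len9p3 t) (4 * t) - (2943 ^ 4)%N%:R / (3 * 2 ^ 43)%N%:R | < eps)%R).
Proof.
have t10 t : (t = 10 \/ 17 <= t)%N -> (10 <= t)%N by case=> [->|/(leq_trans _)->].
split; last split=> [t /t10 ht|]; last exact: density_len9p3_cvg.
- by move=> t /t10; apply: len9p3_code.
- apply: min_length_exists; have [H [rankH [_ [covH _]]]] := len9p3_code ht.
  by exists H.
Qed.
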